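(* $\mathrm{MLR}\le_s\mathrm{KLR}$. That is, there is a single Turing functional $\Phi$ such that for every Kolmogorov--Loveland random $X\in 2^\omega$, $\Phi^X$ is total and is a Martin-Löf random element of $2^\omega$.
   Context: Reals are elements of $2^\omega$, identified with subsets of $\omega$. For $A\in 2^\omega$, $A\upharpoonright n$ is the prefix of $A$ of length $n$, and $K$ denotes prefix-free Kolmogorov complexity. $\mathrm{MLR}$ is the class of Martin-Löf random reals; equivalently, $A\in\mathrm{MLR}$ iff there is a constant $c$ with $K(A\upharpoonright n)\ge n-c$ for all $n$. $\mathrm{KLR}$ is the class of Kolmogorov--Loveland random reals: those $A\in 2^\omega$ on which no partial computable nonmonotonic betting strategy succeeds. A nonmonotonic betting strategy starts with positive rational capital. At each step, as a partial computable function of the finite sequence of (position, bit) pairs seen so far, it chooses a position of $A$ not chosen before, together with a rational stake between $0$ and its current capital and a predicted bit. The value of $A$ at that position is then revealed, and the stake is added to the capital if the prediction is correct and subtracted otherwise. The strategy succeeds on $A$ if, when played against $A$, it makes infinitely many bets and its capital is unbounded. For classes $\mathcal C,\mathcal D\subseteq 2^\omega$, $\mathcal C\le_s\mathcal D$ (Medvedev, i.e. strong or uniform, reducibility) means that there is a Turing functional $\Phi$ such that $\Phi^X\in\mathcal C$ for every $X\in\mathcal D$. *)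

(* Defs.v *)
From Stdlib Require Cantor.
From mathcomp Require Import all_boot all_order all_algebra.

Set Implicit Arguments.
Unset Strict Implicit.
Unset Printing Implicit Defensive.

Import Order.TTheory GRing.Theory Num.Theory.

Definition real := nat -> bool.

Definition prefix_of (A : real) (n : nat) : seq bool := mkseq A n.

(** * Partial recursive functions relative to an oracle *)

Definition npair (a b : nat) : nat := Cantor.to_nat (a, b).
Definition nfst (n : nat) : nat := (Cantor.of_nat n).1.
Definition nsnd (n : nat) : nat := (Cantor.of_nat n).2.

(* Kleene's mu-recursive functions, presented as unary functions: several
   arguments are passed as a single number through the pairing bijection. *)
Inductive code : Type :=
| Zero
| Succ
| Fst
| Snd
| Oracle
| Pair of code & code
| Comp of code & code
| Prec of code & code
| Mu of code.

(* [eval X c n m]: the program [c] with oracle [X] halts on input [n] with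
   output [m].  [Prec f g] maps <a, 0> to f(a) and <a, k+1> to
   g<a, <k, value at <a, k>>>; [Mu f] maps a to the least k such that
   f<a, k> = 0, where f<a, i> must be defined for all i < k. *)
Fixpoint eval (X : real) (c : code) (n m : nat) : Prop :=
  match c with
  | Zero => m = 0
  | Succ => m = n.+1
  | Fst => m = nfst n
  | Snd => m = nsnd n
  | Oracle => m = nat_of_bool (X n)
  | Pair f g => exists a b, [/\ eval X f n a, eval X g n b & m = npair a b]
  | Comp f g => exists2 k, eval X g n k & eval X f k m
  | Prec f g =>
      (fix rec (k y : nat) : Prop :=
         if k is k'.+1 then
           exists2 z, rec k' z & eval X g (npair (nfst n) (npair k' z)) y
         else eval X f (nfst n) y) (nsnd n) m
  | Mu f => eval X f (npair n m) 0 /\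
            forall i, i < m -> exists k, eval X f (npair n i) k.+1
  end.

Definition empty_oracle : real := fun=> false.

Definition evalp (c : code) (n m : nat) : Prop := eval empty_oracle c n m.

Definition halts (c : code) (n : nat) : Prop := exists m, evalp c n m.

Fixpoint nat_of_seq (s : seq nat) : nat :=
  if s is x :: s' then (npair x (nat_of_seq s')).+1 else 0.

Definition nat_of_string (s : seq bool) : nat :=
  nat_of_seq [seq nat_of_bool b | b <- s].

(** * Medvedev reducibility *)

(* The functional with program [c] is total on [X], with value [Y]. *)
Definition computes (c : code) (X Y : real) : Prop :=
  forall n, eval X c n (nat_of_bool (Y n)).

Definition medvedev_le (C D : real -> Prop) : Prop :=
  exists Phi : code, forall X, D X -> exists2 Y, computes Phi X Y & C Y.

Local Open Scope ring_scope.

(** * Martin-Löf randomness *)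

(* The uniform (Lebesgue) outer measure of [V] is at most [q]: for every
   eps > 0, [V] is covered by countably many cylinders of total measure at
   most q + eps.  On open sets this is the uniform measure. *)
Definition measure_le (V : real -> Prop) (q : rat) : Prop :=
  forall eps : rat, 0 < eps ->
  exists s : nat -> seq bool,
    (forall A, V A -> exists i, prefix_of A (size (s i)) = s i) /\
    (forall N, \sum_(i < N) (2%:R^-1 : rat) ^+ size (s i) <= q + eps).

(* [V n] is the open set generated by the n-th member of a uniformly c.e.
   sequence of sets of strings. *)
Definition uniformly_ce_open (V : nat -> real -> Prop) : Prop :=
  exists c : code, forall n A,
    V n A <-> exists k, halts c (npair n (nat_of_string (prefix_of A k))).

Definition ml_test (V : nat -> real -> Prop) : Prop :=
  uniformly_ce_open V /\ forall n, measure_le (V n) (2%:R^-1 ^+ n).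

Definition MLR (A : real) : Prop :=
  forall V, ml_test V -> ~ (forall n, V n A).

(** * Kolmogorov-Loveland randomness *)

(* The (position, bit) pairs seen so far, most recent first. *)
Definition history := seq (nat * bool).

Record bet := Bet { position : nat; stake : rat; prediction : bool }.

(* [None]: the strategy is undefined on that history. *)
Definition strategy := history -> option bet.

Definition nat_of_history (h : history) : nat :=
  nat_of_seq [seq npair pb.1 (nat_of_bool pb.2) | pb <- h].

(* The number <p, <<a, d>, g>> names the bet at position p with stake
   a / (d + 1) and prediction 0 or 1 according to whether g = 0.  Only
   nonnegative stakes need names, since a legal stake is nonnegative. *)
Definition bet_of_nat (v : nat) : bet :=
  let w := nsnd v in
  Bet (nfst v)
      ((nfst (nfst w))%:R / (nsnd (nfst w)).+1%:R)
      (nsnd w != 0%N).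

Definition partial_computable (S : strategy) : Prop :=
  exists c : code, forall h b,
    S h = Some b <-> exists2 v, evalp c (nat_of_history h) v & bet_of_nat v = b.

(* History and capital after [n] bets against [A] from initial capital [q0];
   [None] if some earlier bet is undefined. *)
Fixpoint play (S : strategy) (q0 : rat) (A : real) (n : nat) :
    option (history * rat) :=
  if n is n'.+1 then
    if play S q0 A n' is Some (h, q) then
      if S h is Some b then
        let bit := A (position b) in
        Some ((position b, bit) :: h,
              if bit == prediction b then q + stake b else q - stake b)
      else None
    else None
  else Some ([::], q0).

Definition betting_strategy (S : strategy) (q0 : rat) : Prop :=
  0 < q0 /\
  forall A n h q b, play S q0 A n = Some (h, q) -> S h = Some b ->
    position b \notin [seq pb.1 | pb <- h] /\ 0 <= stake b <= q.

Definition succeeds (S : strategy) (q0 : rat) (A : real) : Prop :=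
  (forall n, play S q0 A n <> None) /\
  (forall B : rat, exists n h q, play S q0 A n = Some (h, q) /\ B < q).

Definition KLR (A : real) : Prop :=
  forall S q0, betting_strategy S q0 -> partial_computable S ->
    ~ succeeds S q0 A.

(* Main.v *)
(** Write [X] as the join of its halves [A_0] and [A_1].  The functional copies
    [A_0], watching a universal Martin-Löf test; when level 0 of the test
    catches the half being copied it switches to the other half, and it raises
    the level after every second switch.  If it switches finitely often, its
    output differs finitely from a half that escapes the test, hence is random,
    the universal test being closed under finite modifications.

    If it switches for ever, then both halves lie in every level, and for some
    [i] there are infinitely many [m] such that level [2 m] catches [A_i] no
    later than it catches [A_(1-i)] (Merkle, Miller, Nies, Reimann, Stephan).
    A nonmonotonic strategy then reads, without betting, enough of [A_(1-i)] to
    learn when level [2 m] catches it, at stage [s_m] say.  The part of level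
    [2 m] enumerated by stage [s_m] is a clopen set of measure at most
    [2^(-2m)].  From the [m]-th bit of [A_i] on, the strategy owns its
    conditional measure, bought at a price of at most [2^(-m)]: a total price of
    at most 2, while every good [m] finally yields 1. *)
From Stdlib Require Cantor.
From Stdlib Require Import Classical ClassicalEpsilon.
From mathcomp Require Import all_boot all_order all_algebra.
From mathcomp Require Import zify ring lra.
Require Import Defs.
Set Implicit Arguments.
Unset Strict Implicit.
Unset Printing Implicit Defensive.

Import Order.TTheory GRing.Theory Num.Theory.

(** * Pairing and determinism of evaluation *)

Lemma nfst_npair a b : nfst (npair a b) = a.
Proof. by rewrite /nfst /npair Cantor.cancel_of_to. Qed.

Lemma nsnd_npair a b : nsnd (npair a b) = b.
Proof. by rewrite /nsnd /npair Cantor.cancel_of_to. Qed.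

Lemma npair_eta n : npair (nfst n) (nsnd n) = n.
Proof. by rewrite /nfst /nsnd /npair -surjective_pairing Cantor.cancel_to_of. Qed.

Definition npairE := (nfst_npair, nsnd_npair).

Lemma leq_nsnd_npair a b : b <= npair a b.
Proof. by rewrite /npair; have := Cantor.to_nat_non_decreasing a b; lia. Qed.

Lemma eval_functional X c n m m' : eval X c n m -> eval X c n m' -> m = m'.
Proof.
elim: c n m m' => [|||||f IHf g IHg|f IHf g IHg|f IHf g IHg|f IHf] n m m' /=.
1-5: by move=> -> ->.
- move=> [a [b [fa gb ->]]] [a' [b' [fa' gb' ->]]].
  by rewrite (IHf _ _ _ fa fa') (IHg _ _ _ gb gb').
- by move=> [k gk fk] [k' gk' fk']; apply: IHf fk _; rewrite (IHg _ _ _ gk gk').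
- elim: (nsnd n) m m' => [|k IHk] m m'; first exact: IHf.
  by move=> [z /IHk zE gz] [z' /zE <-]; exact: IHg.
- move=> [fm ltm] [fm' ltm']; case: (ltngtP m m') => // lt_m.
    by have [k /(IHf _ _ _ fm)] := ltm' _ lt_m.
  by have [k /(IHf _ _ _ fm')] := ltm _ lt_m.
Qed.

(** * Total computable functions *)

(** One program serves all oracles: this covers the functional and, at the empty oracle, the betting
    strategy. *)
Definition computable (f : real -> nat -> nat) : Prop :=
  exists c, forall X n, eval X c n (f X n).

Notation computable_pred P := (computable (fun X n => nat_of_bool (P X n))).

Lemma eq_computable f g :
  (forall X n, f X n = g X n) -> computable f -> computable g.
Proof. by move=> fg [c cP]; exists c => X n; rewrite -fg. Qed.

Lemma computable_id : computable (fun X n => n).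
Proof.
exists (Pair Fst Snd) => X n /=.
by exists (nfst n), (nsnd n); split=> //; rewrite npair_eta.
Qed.

Lemma computable_comp f g : computable f -> computable g ->
  computable (fun X n => f X (g X n)).
Proof. by move=> [c cP] [d dP]; exists (Comp c d) => X n /=; exists (g X n). Qed.

Lemma computable_succ f : computable f -> computable (fun X n => (f X n).+1).
Proof. by apply: (@computable_comp (fun X n => n.+1)); exists Succ. Qed.

Lemma computable_const m : computable (fun X n => m).
Proof. by elim: m => [|m]; [exists Zero | exact: computable_succ]. Qed.

Lemma computable_fst f : computable f -> computable (fun X n => nfst (f X n)).
Proof. by apply: (@computable_comp (fun X n => nfst n)); exists Fst. Qed.

Lemma computable_snd f : computable f -> computable (fun X n => nsnd (f X n)).
Proof. by apply: (@computable_comp (fun X n => nsnd n)); exists Snd. Qed.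

Lemma computable_oracle f : computable f -> computable_pred (fun X n => X (f X n)).
Proof.
by apply: (@computable_comp (fun X n => nat_of_bool (X n))); exists Oracle.
Qed.

Lemma computable_pair f g : computable f -> computable g ->
  computable (fun X n => npair (f X n) (g X n)).
Proof.
by move=> [c cP] [d dP]; exists (Pair c d) => X n /=; exists (f X n), (g X n).
Qed.

Lemma computable_app2 (F : real -> nat -> nat -> nat) f g :
  computable (fun X p => F X (nfst p) (nsnd p)) -> computable f -> computable g ->
  computable (fun X n => F X (f X n) (g X n)).
Proof.
move=> cF cf cg; apply: eq_computable (computable_comp cF (computable_pair cf cg)).
by move=> X n; rewrite !npairE.
Qed.

Lemma computable_app3 (F : real -> nat -> nat -> nat -> nat) f g h :
  computable (fun X p => F X (nfst p) (nfst (nsnd p)) (nsnd (nsnd p))) ->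
  computable f -> computable g -> computable h ->
  computable (fun X n => F X (f X n) (g X n) (h X n)).
Proof.
move=> cF cf cg ch.
apply: eq_computable (computable_comp cF (computable_pair cf (computable_pair cg ch))).
by move=> X n; rewrite !npairE.
Qed.

(** [Prec] keeps its argument in the first component of the pair, so the iterated function may use
    [n] as a parameter. *)
Lemma computable_iteri (k : real -> nat -> nat) G z :
  computable k -> computable z ->
  computable (fun X p => G X (nfst p) (nfst (nsnd p)) (nsnd (nsnd p))) ->
  computable (fun X n => iteri (k X n) (G X n) (z X n)).
Proof.
move=> ck [cz czP] [cG cGP].
apply: (@computable_app2 (fun X n j => iteri j (G X n) (z X n)) (fun X n => n));
  [|exact: computable_id|exact: ck].
exists (Prec cz cG) => X n /=; elim: (nsnd n) => [|j IHj] /=; first exact: czP.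
exists (iteri j (G X (nfst n)) (z X (nfst n))) => //.
by have := cGP X (npair (nfst n) (npair j (iteri j (G X (nfst n)) (z X (nfst n)))));
  rewrite !npairE.
Qed.

Lemma computable_iter (k : real -> nat -> nat) G z :
  computable k -> computable z ->
  computable (fun X p => G X (nfst p) (nsnd p)) ->
  computable (fun X n => iter (k X n) (G X n) (z X n)).
Proof.
move=> ck cz cG.
apply: (@eq_computable (fun X n => iteri (k X n) (fun=> G X n) (z X n))).
  by move=> X n; elim: (k X n) => //= j ->.
apply: computable_iteri => //.
apply: (computable_app2 cG); last by do 2!apply: computable_snd; exact: computable_id.
by apply: computable_fst; exact: computable_id.
Qed.

Ltac computable_base :=
  lazymatch goal with
  | |- computable (fun X n => @?f X n) =>
    first [ exact: computable_const | exact: computable_id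
          | exact: (computable_fst computable_id)
          | exact: (computable_snd computable_id)
          | exact: (computable_fst (computable_snd computable_id))
          | exact: (computable_snd (computable_snd computable_id)) ]
  end.

(** * Arithmetic and bounded search *)

Lemma computable_pred1 f : computable f -> computable (fun X n => (f X n).-1).
Proof.
apply: (@computable_comp (fun X n => n.-1)).
apply: (@eq_computable (fun X n => iteri n (fun i _ => i) 0)); first by move=> X [].
by apply: computable_iteri; computable_base.
Qed.

Lemma computable_add f g : computable f -> computable g ->
  computable (fun X n => f X n + g X n).
Proof.
move=> cf cg; apply: (@eq_computable (fun X n => iter (f X n) succn (g X n))).
  by move=> X n; rewrite iter_succn addnC.
by apply: computable_iter => //; apply: computable_succ; computable_base.
Qed.

Lemma computable_sub f g : computable f -> computable g ->
  computable (fun X n => f X n - g X n).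
Proof.
move=> cf cg; apply: (@eq_computable (fun X n => iter (g X n) predn (f X n))).
  by move=> X n; elim: (g X n) => [|k /= ->]; rewrite ?subn0 ?subnS.
by apply: computable_iter => //; apply: computable_pred1; computable_base.
Qed.

Lemma computable_sum (k : real -> nat -> nat) (F : real -> nat -> nat -> nat) :
  computable k -> computable (fun X p => F X (nfst p) (nsnd p)) ->
  computable (fun X n => \sum_(0 <= i < k X n) F X n i).
Proof.
move=> ck cF.
apply: (@eq_computable (fun X n => iteri (k X n) (fun i z => z + F X n i) 0)).
  move=> X n; elim: (k X n) => [|j /= ->]; first by rewrite big_geq.
  by rewrite big_nat_recr.
apply: computable_iteri => //; first exact: computable_const.
by apply: computable_add; [|apply: (computable_app2 cF)]; computable_base.
Qed.

Lemma computable_mul f g : computable f -> computable g ->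
  computable (fun X n => f X n * g X n).
Proof.
move=> cf cg; apply: (@eq_computable (fun X n => \sum_(0 <= i < f X n) g X n)).
  by move=> X n; rewrite sum_nat_const_nat subn0.
by apply: computable_sum => //; apply: computable_comp cg _; computable_base.
Qed.

Lemma computable_exp f g : computable f -> computable g ->
  computable (fun X n => f X n ^ g X n).
Proof.
move=> cf cg; apply: (@eq_computable (fun X n => iter (g X n) (muln (f X n)) 1)).
  by move=> X n; elim: (g X n) => //= k ->; rewrite expnS.
apply: computable_iter => //; first exact: computable_const.
by apply: computable_mul; [apply: computable_comp cf _|]; computable_base.
Qed.

Lemma computable_neg P : computable_pred P -> computable_pred (fun X n => ~~ P X n).
Proof.
move=> cP; apply: (@eq_computable (fun X n => 1 - P X n)); first by move=> X n; case: (P X n).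
by apply: computable_sub => //; exact: computable_const.
Qed.

Lemma computable_leq f g : computable f -> computable g ->
  computable_pred (fun X n => f X n <= g X n).
Proof.
move=> cf cg; apply: (@eq_computable (fun X n => 1 - (f X n - g X n))).
  by move=> X n; rewrite -subn_eq0; case: (f X n - g X n).
by do !apply: computable_sub => //; exact: computable_const.
Qed.

Lemma computable_and P Q : computable_pred P -> computable_pred Q ->
  computable_pred (fun X n => P X n && Q X n).
Proof.
move=> cP cQ; apply: (@eq_computable (fun X n => P X n * Q X n)).
  by move=> X n; rewrite mulnb.
exact: computable_mul.
Qed.

Lemma computable_eq f g : computable f -> computable g ->
  computable_pred (fun X n => f X n == g X n).
Proof.
move=> cf cg.
apply: (@eq_computable (fun X n => nat_of_bool ((f X n <= g X n) && (g X n <= f X n)))).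
  by move=> X n; rewrite -eqn_leq.
by apply: computable_and; exact: computable_leq.
Qed.

Lemma computable_eqb P Q : computable_pred P -> computable_pred Q ->
  computable_pred (fun X n => P X n == Q X n).
Proof.
move=> cP cQ; apply: eq_computable (computable_eq cP cQ).
by move=> X n; case: (P X n); case: (Q X n).
Qed.

Lemma computable_addb P Q : computable_pred P -> computable_pred Q ->
  computable_pred (fun X n => P X n (+) Q X n).
Proof.
move=> cP cQ; apply: eq_computable (computable_neg (computable_eqb cP cQ)).
by move=> X n; case: (P X n); case: (Q X n).
Qed.

Lemma computable_if P f g : computable_pred P -> computable f -> computable g ->
  computable (fun X n => if P X n then f X n else g X n).
Proof.
move=> cP cf cg; apply: (@eq_computable (fun X n => P X n * f X n + (~~ P X n) * g X n)).
  by move=> X n; case: (P X n); rewrite !(mul1n, mul0n) // addn0.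
by apply: computable_add; apply: computable_mul => //; exact: computable_neg.
Qed.

Lemma computable_odd f : computable f -> computable_pred (fun X n => odd (f X n)).
Proof.
apply: (@computable_comp (fun X n => nat_of_bool (odd n))).
apply: (@eq_computable (fun X n => iter n (fun b => 1 - b) 0)).
  by move=> X n; elim: n => //= n ->; case: (odd n).
by apply: computable_iter; try apply: computable_sub; computable_base.
Qed.

Lemma computable_has (k : real -> nat -> nat) P :
  computable k -> computable_pred (fun X p => P X (nfst p) (nsnd p)) ->
  computable_pred (fun X n => has (P X n) (iota 0 (k X n))).
Proof.
move=> ck cP.
apply: (@eq_computable (fun X n => nat_of_bool (0 < \sum_(0 <= i < k X n) P X n i))).
  move=> X n; rewrite has_count -sum1_count [in RHS]big_mkcond /index_iota subn0.
  by congr (nat_of_bool (0 < _)); apply: eq_bigr => i _; case: ifP.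
by apply: computable_leq; [computable_base | apply: computable_sum].
Qed.

Lemma computable_all (k : real -> nat -> nat) P :
  computable k -> computable_pred (fun X p => P X (nfst p) (nsnd p)) ->
  computable_pred (fun X n => all (P X n) (iota 0 (k X n))).
Proof.
move=> ck cP.
have := computable_neg (@computable_has k (fun X n i => ~~ P X n i) ck (computable_neg cP)).
apply: eq_computable.
by move=> X n; rewrite (has_predC (P X n)) negbK.
Qed.

(** The quotient counts the positive multiples of the divisor up to the dividend. *)
Lemma computable_divn f g : computable f -> computable g ->
  (forall X n, 0 < g X n) -> computable (fun X n => f X n %/ g X n).
Proof.
move=> cf cg g_gt0.
apply: (@eq_computable (fun X n => \sum_(0 <= i < f X n) (i.+1 * g X n <= f X n))).
  move=> X n; transitivity (\sum_(0 <= i < f X n) (i < f X n %/ g X n)).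
    by apply: eq_bigr => i _; rewrite leq_divRL.
  have := leq_div (f X n) (g X n); move: (_ %/ _) => q; move: (f X n) => m.
  elim: m => [|m IHm]; first by rewrite big_geq // leqn0 => /eqP.
  rewrite big_nat_recr //= leq_eqVlt => /orP[/eqP->|qm].
    by rewrite ltnSn (eq_big_nat _ _ (F2 := fun=> 1)) ?sum_nat_const_nat; [lia|lia].
  by rewrite IHm //; lia.
apply: computable_sum => //; apply: computable_leq.
  by apply: computable_mul; [apply: computable_succ | apply: computable_comp cg _];
    computable_base.
by apply: computable_comp cf _; computable_base.
Qed.

Lemma computable_div_exp2 f g : computable f -> computable g ->
  computable (fun X n => f X n %/ 2 ^ g X n).
Proof.
move=> cf cg; apply: computable_divn => //; last by move=> X n; rewrite expn_gt0.
by apply: computable_exp => //; exact: computable_const.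
Qed.

(* Extended below with the functions that get a closure lemma of their own. *)
Ltac computable_extra := fail.
Ltac computable_step :=
  lazymatch goal with
  | |- computable (fun X n => nat_of_bool (~~ @?P X n)) =>
    apply: (@computable_neg P)
  | |- computable (fun X n => nat_of_bool (@?P X n && @?Q X n)) =>
    apply: (@computable_and P Q)
  | |- computable (fun X n => nat_of_bool (@?P X n (+) @?Q X n)) =>
    apply: (@computable_addb P Q)
  | |- computable (fun X n => nat_of_bool (@?f X n <= @?g X n)) =>
    apply: (@computable_leq f g)
  | |- computable (fun X n => nat_of_bool (@?f X n == @?g X n)) =>
    first [apply: (@computable_eq f g) | apply: (@computable_eqb f g)]
  | |- computable (fun X n => nat_of_bool (odd (@?f X n))) =>
    apply: (@computable_odd f)
  | |- computable (fun X n => nat_of_bool (has (@?P X n) (iota 0 (@?k X n)))) =>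
    apply: (@computable_has k P)
  | |- computable (fun X n => nat_of_bool (all (@?P X n) (iota 0 (@?k X n)))) =>
    apply: (@computable_all k P)
  | |- computable (fun X n => (@?f X n) + (@?g X n)) =>
    apply: (@computable_add f g)
  | |- computable (fun X n => (@?f X n) - (@?g X n)) =>
    apply: (@computable_sub f g)
  | |- computable (fun X n => (@?f X n) * (@?g X n)) =>
    apply: (@computable_mul f g)
  | |- computable (fun X n => (@?f X n) ^ (@?g X n)) =>
    apply: (@computable_exp f g)
  | |- computable (fun X n => (@?f X n) %/ 2 ^ (@?g X n)) =>
    apply: (@computable_div_exp2 f g)
  | |- computable (fun X n => npair (@?f X n) (@?g X n)) =>
    apply: (@computable_pair f g)
  | |- computable (fun X n => \sum_(0 <= i < @?k X n) @?F X n i) =>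
    apply: (@computable_sum k F)
  | |- computable (fun X n => iter (@?k X n) (@?G X n) (@?z X n)) =>
    apply: (@computable_iter k G z)
  | |- computable (fun X n => iteri (@?k X n) (@?G X n) (@?z X n)) =>
    apply: (@computable_iteri k G z)
  | |- computable (fun X n => nfst (@?f X n)) => apply: (@computable_fst f)
  | |- computable (fun X n => nsnd (@?f X n)) => apply: (@computable_snd f)
  | |- computable (fun X n => (@?f X n).-1) => apply: (@computable_pred1 f)
  | |- computable (fun X n => (@?f X n).+1) => apply: (@computable_succ f)
  | |- computable (fun X n => nat_of_bool (X (@?f X n))) =>
    apply: (@computable_oracle f)
  | H : computable ?f |- computable (fun X n => ?f X (@?g X n)) =>
    apply: (@computable_comp f g H)
  | |- computable (fun X n => if _ then _ else _) => apply: computable_if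
  end.
Ltac computability :=
  repeat first [ assumption | exact: computable_const | exact: computable_id
               | progress cbv beta | computable_step
               | computable_extra ].
(** * A universal machine *)

Fixpoint code_number (c : code) : nat :=
  match c with
  | Zero => npair 0 0
  | Succ => npair 1 0
  | Fst => npair 2 0
  | Snd => npair 3 0
  | Oracle => npair 4 0
  | Pair f g => npair 5 (npair (code_number f) (code_number g))
  | Comp f g => npair 6 (npair (code_number f) (code_number g))
  | Prec f g => npair 7 (npair (code_number f) (code_number g))
  | Mu f => npair 8 (code_number f)
  end.

Definition push (fr K : nat) : nat := (npair fr K).+1.

(* A state <v, K> holds a value v and a stack K of frames <t, d>.  The frames
   with t < 9 are programs to be run on v; those with t >= 9 are the
   continuations of Pair (9 and 10), Prec (11) and Mu (12).  The oracle is
   empty. *)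
Definition step_frame (t d v K : nat) : nat :=
  if t == 0 then npair 0 K else
  if t == 1 then npair v.+1 K else
  if t == 2 then npair (nfst v) K else
  if t == 3 then npair (nsnd v) K else
  if t == 4 then npair 0 K else
  if t == 5 then
    npair v (push (nfst d) (push (npair 9 (npair (nsnd d) v)) K)) else
  if t == 6 then npair v (push (nsnd d) (push (nfst d) K)) else
  if t == 7 then
    npair (nfst v) (push (nfst d)
      (push (npair 11 (npair (npair (nsnd d) (nfst v)) (npair 0 (nsnd v)))) K)) else
  if t == 8 then
    npair (npair v 0) (push d (push (npair 12 (npair d (npair v 0))) K)) else
  if t == 9 then npair (nsnd d) (push (nfst d) (push (npair 10 v) K)) else
  if t == 10 then npair (npair d v) K else
  if t == 11 then
    if nfst (nsnd d) == nsnd (nsnd d) then npair v K else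
    npair (npair (nsnd (nfst d)) (npair (nfst (nsnd d)) v))
      (push (nfst (nfst d))
        (push (npair 11 (npair (nfst d)
                 (npair (nfst (nsnd d)).+1 (nsnd (nsnd d))))) K)) else
  if v == 0 then npair (nsnd (nsnd d)) K else
  npair (npair (nfst (nsnd d)) (nsnd (nsnd d)).+1)
    (push (nfst d)
      (push (npair 12 (npair (nfst d)
               (npair (nfst (nsnd d)) (nsnd (nsnd d)).+1))) K)).

Definition step (st : nat) : nat :=
  if nsnd st == 0 then st else
  step_frame (nfst (nfst (nsnd st).-1)) (nsnd (nfst (nsnd st).-1))
    (nfst st) (nsnd (nsnd st).-1).

Definition halted (s st : nat) : bool := nsnd (iter s step st) == 0.

Local Opaque npair nfst nsnd.

Lemma step_push v t d K :
  step (npair v (push (npair t d) K)) = step_frame t d v K.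
Proof. by rewrite /step /push !npairE /= ?npairE. Qed.

Lemma haltedS s st : halted s.+1 st = halted s (step st).
Proof. by rewrite /halted iterSr. Qed.

Lemma halted_leq s s' st : s <= s' -> halted s st -> halted s' st.
Proof.
move=> /subnK <- /eqP s_halts; rewrite /halted iterD.
by elim: (s' - s) => [|k /eqP IHk] /=; [apply/eqP | rewrite {1}/step IHk IHk].
Qed.

Lemma halted_push s v t d K : halted s (npair v (push (npair t d) K)) ->
  exists2 s', s = s'.+1 & halted s' (step_frame t d v K).
Proof.
case: s => [|s]; first by rewrite /halted /= npairE.
by rewrite haltedS step_push; exists s.
Qed.

Definition eval_prec (F G : nat -> nat -> Prop) (a : nat) : nat -> nat -> Prop :=
  fix rec (k y : nat) : Prop :=
    if k is k'.+1 then exists2 z, rec k' z & G (npair a (npair k' z)) y else F a y.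

Lemma evalp_prec f g n m :
  evalp (Prec f g) n m = eval_prec (evalp f) (evalp g) (nfst n) (nsnd n) m.
Proof. by []. Qed.

(** Soundness of the machine. The strict decrease [s' < s] serves [Mu], whose search is followed by
    induction on the number of steps left. *)
Lemma halted_eval c n K s : halted s (npair n (push (code_number c) K)) ->
  exists m s', [/\ s' < s, evalp c n m & halted s' (npair m K)].
Proof.
elim: c n K s => [|||||f IHf g IHg|f IHf g IHg|f IHf g IHg|f IHf] n K s /=
  /halted_push[{}s ->].
- by exists 0, s.
- by exists n.+1, s.
- by exists (nfst n), s.
- by exists (nsnd n), s.
- by exists 0, s.
- rewrite /step_frame /= ?npairE => /IHf[a [s1 [lt_s1 fa]]].
  move=> /halted_push[s1' ? /=]; rewrite /step_frame /= ?npairE.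
  move=> /IHg[b [s2 [lt_s2 gb]]] /halted_push[s3 ?]; rewrite /step_frame /= => s3P.
  by exists (npair a b), s3; split=> //; [lia | exists a, b].
- rewrite /step_frame /= ?npairE => /IHg[k [s1 [lt_s1 gk]]].
  move=> /IHf[m [s2 [lt_s2 fm s2P]]]; exists m, s2; split=> //; [lia | by exists k].
- rewrite /step_frame /= ?npairE => /IHf[z [s1 [lt_s1 fz]]].
  (* [k] counts the rounds of the recursion still to come. *)
  suff loop k i y s2 : s2 < s -> i + k = nsnd n ->
      eval_prec (evalp f) (evalp g) (nfst n) i y ->
      halted s2 (npair y (push (npair 11 (npair (npair (code_number g) (nfst n))
                                         (npair i (nsnd n)))) K)) ->
    exists m s', [/\ s' < s.+1, evalp (Prec f g) n m & halted s' (npair m K)].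
    exact: (loop (nsnd n) 0 z s1).
  elim: k i y s2 => [|k IHk] i y s2 lt_s2 ik yP /halted_push[s3 ?];
    rewrite /step_frame /= ?npairE.
    rewrite -ik addn0 eqxx => s3P; exists y, s3; split=> //; first by lia.
    by rewrite evalp_prec -ik addn0.
  rewrite ifN; last by lia.
  move=> /IHg[x [s4 [lt_s4 gx]]]; apply: IHk; [lia|lia|by exists y].
- rewrite /step_frame /= ?npairE => s_halts.
  suff loop s1 i : s1 <= s ->
      (forall j, j < i -> exists k, evalp f (npair n j) k.+1) ->
      halted s1 (npair (npair n i) (push (code_number f)
        (push (npair 12 (npair (code_number f) (npair n i))) K))) ->
    exists m s', [/\ s' < s.+1, evalp (Mu f) n m & halted s' (npair m K)].
    exact: (loop s 0).
  elim/ltn_ind: s1 i => s1 IHs1 i le_s1 ltP /IHf[r [s2 [lt_s2 fr]]].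
  move=> /halted_push[s3 ?]; rewrite /step_frame /= ?npairE.
  case: eqP => [r0|r_neq0] s3P.
    exists i, s3; split=> //; first by lia.
    by split=> //; rewrite r0 in fr.
  apply: (IHs1 s3) s3P; [lia|lia|].
  move=> j; rewrite ltnS leq_eqVlt => /orP[/eqP->|/ltP //].
  by case: r r_neq0 fr => // r _ fr; exists r.
Qed.

Definition reaches st st' := exists s, iter s step st = st'.

Lemma reaches_refl st : reaches st st. Proof. by exists 0. Qed.

Lemma reaches_trans st2 st1 st3 : reaches st1 st2 -> reaches st2 st3 -> reaches st1 st3.
Proof. by move=> [s <-] [s' <-]; exists (s' + s); rewrite iterD. Qed.

Lemma reaches_push v t d K st : reaches (step_frame t d v K) st ->
  reaches (npair v (push (npair t d) K)) st.
Proof. by rewrite -step_push => -[s sP]; exists s.+1; rewrite iterSr. Qed.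

(** Completeness of the machine, converse to [halted_eval]. The stack [K] is arbitrary so that the
    frames below can continue the run of a subprogram. *)
Lemma eval_reaches c n m K : evalp c n m ->
  reaches (npair n (push (code_number c) K)) (npair m K).
Proof.
elim: c n m K => [|||||f IHf g IHg|f IHf g IHg|f IHf g IHg|f IHf] n m K.
1-5: by move=> /= ->; apply: reaches_push; exact: reaches_refl.
- move=> /= [a [b [fa gb ->]]]; apply: reaches_push; rewrite /step_frame /= ?npairE.
  apply: reaches_trans (IHf _ _ _ fa) _.
  apply: reaches_push; rewrite /step_frame /= ?npairE.
  apply: reaches_trans (IHg _ _ _ gb) _.
  by apply: reaches_push; exact: reaches_refl.
- move=> [k gk fk]; apply: reaches_push; rewrite /step_frame /= ?npairE.
  by apply: reaches_trans (IHg _ _ _ gk) _; exact: IHf.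
- rewrite evalp_prec /=.
  suff loop i : i <= nsnd n -> forall y, eval_prec (evalp f) (evalp g) (nfst n) i y ->
      reaches (npair n (push (npair 7 (npair (code_number f) (code_number g))) K))
        (npair y (push (npair 11 (npair (npair (code_number g) (nfst n))
                                        (npair i (nsnd n)))) K)).
    move=> /(loop _ (leqnn _)) nm; apply: reaches_trans nm _.
    by apply: reaches_push; rewrite /step_frame /= ?npairE eqxx; exact: reaches_refl.
  elim: i => [|i IHi] le_i y.
    move=> /IHf fy; apply: reaches_push; rewrite /step_frame /= ?npairE.
    exact: fy.
  move=> [z recz gy]; apply: reaches_trans (IHi (ltnW le_i) _ recz) _.
  apply: reaches_push; rewrite /step_frame /= ?npairE ifN; last by lia.
  exact: IHg.
- move=> [fm ltm].
  suff loop i : i <= m -> 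
      reaches (npair n (push (npair 8 (code_number f)) K))
        (npair (npair n i) (push (code_number f)
           (push (npair 12 (npair (code_number f) (npair n i))) K))).
    apply: reaches_trans (loop _ (leqnn _)) _.
    apply: reaches_trans (IHf _ _ _ fm) _.
    by apply: reaches_push; rewrite /step_frame /= ?npairE; exact: reaches_refl.
  elim: i => [|i IHi] le_i; first by apply: reaches_push; exact: reaches_refl.
  apply: reaches_trans (IHi (ltnW le_i)) _.
  have [k fk] := ltm _ le_i.
  apply: reaches_trans (IHf _ _ _ fk) _.
  by apply: reaches_push; rewrite /step_frame /= ?npairE; exact: reaches_refl.
Qed.

(** The number of a code is itself a frame [<t, d>], so a program starts with its number pushed on
    the empty stack [0]. *)
Definition halts_in (e n s : nat) : bool := halted s (npair n (push e 0)).

Lemma halts_in_leq e n s s' : s <= s' -> halts_in e n s -> halts_in e n s'.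
Proof. exact: halted_leq. Qed.

Lemma halts_inP c n : halts c n <-> exists s, halts_in (code_number c) n s.
Proof.
split=> [[m cm]|[s /halted_eval[m [_ [_ cm _]]]]]; last by exists m.
have [s sP] := eval_reaches 0 cm.
by exists s; rewrite /halts_in /halted sP npairE.
Qed.

Lemma computable_step_frame t d v K : computable t -> computable d -> computable v ->
  computable K ->
  computable (fun X n => step_frame (t X n) (d X n) (v X n) (K X n)).
Proof.
by move=> ct cd cv cK; rewrite /step_frame /push; computability.
Qed.
Ltac computable_extra ::=
  lazymatch goal with
  | |- computable (fun X n => step_frame _ _ _ _) => apply: computable_step_frame
  end.

Lemma computable_step_machine f : computable f -> computable (fun X n => step (f X n)).
Proof. by move=> cf; rewrite /step; computability. Qed.
Ltac computable_extra ::=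
  lazymatch goal with
  | |- computable (fun X n => step _) => apply: computable_step_machine
  end.

Lemma computable_halts_in e f s : computable e -> computable f -> computable s ->
  computable_pred (fun X n => halts_in (e X n) (f X n) (s X n)).
Proof.
move=> ce cf cs.
apply: (computable_app3 (F := fun X e f s => nat_of_bool (halts_in e f s))) => //.
by rewrite /halts_in /halted /push; computability.
Qed.

(** * Finite strings as numbers *)

Definition bit (w i : nat) : bool := odd (w %/ 2 ^ i).

(** A prefix as a number, least significant bit first: truncation to [j] bits is then reduction
    modulo [2 ^ j]. *)
Definition pre (A : real) (k : nat) : nat := \sum_(0 <= i < k) A i * 2 ^ i.

Lemma preS A k : pre A k.+1 = pre A k + A k * 2 ^ k.
Proof. by rewrite /pre big_nat_recr. Qed.

Lemma ltn_pre A k : pre A k < 2 ^ k.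
Proof.
elim: k => [|k IHk]; first by rewrite /pre big_geq.
by rewrite preS expnS; case: (A k); lia.
Qed.

Lemma eq_pre A B k : (forall i, i < k -> A i = B i) -> pre A k = pre B k.
Proof. by move=> AB; apply: eq_big_nat => i /andP[_ /AB ->]. Qed.

Lemma bitDl k w v i : i < k -> bit (w + 2 ^ k * v) i = bit w i.
Proof.
move=> lt_ik; have -> : k = i + (k - i.+1).+1 by lia.
rewrite /bit expnD -mulnA addnC mulnC divnMDl ?expn_gt0 // expnS -mulnA.
by rewrite oddD oddM.
Qed.

Lemma bit_mod w k i : i < k -> bit (w %% 2 ^ k) i = bit w i.
Proof. by move=> lt_ik; rewrite {2}(divn_eq w (2 ^ k)) addnC mulnC bitDl. Qed.

Lemma bit_pre A k i : i < k -> bit (pre A k) i = A i.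
Proof.
elim: k => // k IHk; rewrite ltnS leq_eqVlt preS => /orP[/eqP->|lt_ik].
  by rewrite /bit divnDMl ?expn_gt0 // divn_small ?ltn_pre //; case: (A k).
by rewrite mulnC bitDl // IHk.
Qed.

Lemma pre_mod A j k : j <= k -> pre A k %% 2 ^ j = pre A j.
Proof.
move=> /subnKC <-; elim: (k - j) => [|i IHi].
  by rewrite addn0 modn_small // ltn_pre.
by rewrite addnS preS expnD mulnCA -modnDm modnMr addn0 modn_mod.
Qed.

Lemma pre_bit w k : pre (bit w) k = w %% 2 ^ k.
Proof.
elim: k => [|k IHk]; first by rewrite /pre big_geq // modn1.
rewrite preS IHk /bit; set q := w %/ 2 ^ k; set r := w %% 2 ^ k.
have -> : w = q %/ 2 * 2 ^ k.+1 + (r + odd q * 2 ^ k).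
  rewrite expnS mulnA addnCA -mulnDl -modn2 -divn_eq addnC; exact: divn_eq.
rewrite modnMDl modn_small //; have : r < 2 ^ k by rewrite ltn_mod expn_gt0.
by rewrite expnS; case: (odd q); lia.
Qed.

(** Lists are coded from the right, so a loop building the code adds the last bit first. In this
    form the code of a prefix is visibly computable. *)
Lemma nat_of_string_mkseq A k : nat_of_string (mkseq A k) =
  iteri k (fun i z => (npair (A (k - i.+1)) z).+1) 0.
Proof.
elim: k A => // k IHk A.
rewrite /mkseq /= -[1]addn0 iotaDl -map_comp /nat_of_string /= subnn.
congr (npair _ _).+1; have := IHk (A \o S); rewrite /nat_of_string => ->.
have: k <= k by []; elim: {1 3 5}k => //= i IHi lt_ik; rewrite IHi; last exact: ltnW.
by rewrite subSn.
Qed.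

(** * A universal Martin-Löf test *)

(* The number [d] stands for a finite modification: the [n]-th open set of the
   test [e] is pulled back along the bitwise exclusive or with [d]. *)
Definition raw_test (e d n s w : nat) : bool :=
  has (fun k => halts_in e
         (npair n (nat_of_string (mkseq (fun i => bit w i (+) bit d i) k))) s)
      (iota 0 s.+1).

(** For [w < 2 ^ k]: the number of extensions of the [k]-bit string [w] by [l] bits that lie in
    [P]. *)
Definition count (P : nat -> bool) (l w k : nat) : nat :=
  \sum_(0 <= v < 2 ^ l) P (w + 2 ^ k * v).

Definition small (e d n s : nat) : bool :=
  count (raw_test e d n s) s 0 0 * 2 ^ n <= 2 ^ s.

(** A stage is accepted only if the set enumerated by then has measure at most [2^-n]. This forces
    the bound on every index and loses nothing of a genuine test. *)
Definition trimmed_test (e d n s w : nat) : bool :=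
  has (fun t => raw_test e d n t w && small e d n t) (iota 0 s.+1).

(** Taking member [j + i + 1] of test number [i] makes the measures sum to at most [2^-j]. *)
Definition universal_test (j s w : nat) : bool :=
  has (fun i => trimmed_test (nfst i) (nsnd i) (j + i.+1) s w) (iota 0 s).

Lemma computable_raw_test e d n s w : computable e -> computable d -> computable n ->
  computable s -> computable w -> computable_pred (fun X p =>
    raw_test (e X p) (d X p) (n X p) (s X p) (w X p)).
Proof.
move=> ce cd cn cs cw; rewrite /raw_test; computability.
apply: computable_halts_in; computability.
apply: eq_computable => [X p|]; first by symmetry; exact: nat_of_string_mkseq.
by rewrite /bit; computability.
Qed.
Ltac computable_extra ::=
  lazymatch goal with
  | |- computable (fun X n => nat_of_bool (raw_test _ _ _ _ _)) =>
    apply: computable_raw_test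
  end.

Lemma computable_trimmed_test e d n s w : computable e -> computable d ->
  computable n -> computable s -> computable w -> computable_pred (fun X p =>
    trimmed_test (e X p) (d X p) (n X p) (s X p) (w X p)).
Proof.
by move=> ce cd cn cs cw; rewrite /trimmed_test /small /count; computability.
Qed.
Ltac computable_extra ::=
  lazymatch goal with
  | |- computable (fun X n => nat_of_bool (trimmed_test _ _ _ _ _)) =>
    apply: computable_trimmed_test
  end.

Lemma computable_universal_test j s w : computable j -> computable s -> computable w ->
  computable_pred (fun X n => universal_test (j X n) (s X n) (w X n)).
Proof. by move=> cj cs cw; rewrite /universal_test; computability. Qed.
Ltac computable_extra ::=
  lazymatch goal with
  | |- computable (fun X n => nat_of_bool (universal_test _ _ _)) =>
    apply: computable_universal_test
  end.

(** * Conditional measure *)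

Definition depends_below (s : nat) (P : nat -> bool) : Prop :=
  forall w, P (w %% 2 ^ s) = P w.

Lemma depends_below_pre s P A k : depends_below s P -> s <= k ->
  P (pre A k) = P (pre A s).
Proof. by move=> dP le_sk; rewrite -dP pre_mod. Qed.

Lemma depends_belowD s P w v k : depends_below s P -> s <= k ->
  P (w + 2 ^ k * v) = P w.
Proof.
move=> dP /subnKC <-; rewrite -dP expnD -mulnA mulnC addnC modnMDl; exact: dP.
Qed.

Lemma depends_below_leq s s' P : s <= s' -> depends_below s P -> depends_below s' P.
Proof. by move=> le_ss' dP w; rewrite -dP modn_dvdm ?dP // dvdn_exp2l. Qed.

Lemma sum_nat_double (F : nat -> nat) m :
  \sum_(0 <= v < m.*2) F v = \sum_(0 <= v < m) (F v.*2 + F v.*2.+1).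
Proof.
elim: m => [|m IHm]; first by rewrite !big_geq.
by rewrite doubleS !big_nat_recr //= IHm addnA.
Qed.

(** Splits on the lowest free bit; [count_stable] splits on the highest, on which [P] does not
    depend. *)
Lemma count_low P l w k :
  count P l.+1 w k = count P l w k.+1 + count P l (w + 2 ^ k) k.+1.
Proof.
rewrite /count expnS mul2n sum_nat_double big_split /=; congr (_ + _).
  by apply: eq_bigr => v _; rewrite expnS -mul2n mulnCA mulnA.
by apply: eq_bigr => v _; rewrite expnS -mul2n mulnS -addnA [2 ^ k * (2 * v)]mulnCA mulnA.
Qed.

Lemma count_stable s P l w k : depends_below s P -> s <= k + l ->
  count P l.+1 w k = 2 * count P l w k.
Proof.
move=> dP le_s; rewrite /count expnS mul2n -addnn (big_cat_nat (leq0n (2 ^ l))) ?leq_addr //=.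
rewrite [X in _ + X](_ : _ = \sum_(0 + 2 ^ l <= v < 2 ^ l + 2 ^ l) P (w + 2 ^ k * v)) //.
rewrite big_addn addnK mul2n -addnn; congr (_ + _).
apply: eq_bigr => v _; rewrite mulnDr -expnD addnA -[2 ^ (k + l)]muln1.
by rewrite (depends_belowD _ _ dP).
Qed.

Lemma count_stableD s P l j w k : depends_below s P -> s <= k + l ->
  count P (l + j) w k = 2 ^ j * count P l w k.
Proof.
move=> dP le_s; elim: j => [|j IHj]; first by rewrite addn0 mul1n.
rewrite addnS (count_stable _ dP) ?IHj ?expnS ?mulnA //.
by rewrite addnA (leq_trans le_s) ?leq_addr.
Qed.

Lemma count_leq (P Q : nat -> bool) l w k :
  (forall v, P v -> Q v) -> count P l w k <= count Q l w k.
Proof.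
move=> PQ; apply: leq_sum => v _.
by move: (PQ (w + 2 ^ k * v)); case: (P _) => // ->.
Qed.

(** A cylinder is part of the whole space; the induction frees the bits of the prefix from the top
    down. *)
Lemma count_prefix P l w k : w < 2 ^ k -> count P l w k <= count P (k + l) 0 0.
Proof.
elim: k l w => [|k IHk] l w.
  by rewrite ltnS leqn0 => /eqP->; rewrite add0n.
rewrite expnS => lt_w; rewrite addSnnS.
have [lt_wk|le_kw] := ltnP w (2 ^ k).
  by apply: leq_trans (IHk l.+1 w lt_wk); rewrite count_low leq_addr.
apply: leq_trans (IHk l.+1 (w - 2 ^ k) _); last by lia.
by rewrite count_low subnK // leq_addl.
Qed.

Local Open Scope ring_scope.

(* The measure of [P], which depends on the first [s] bits, in the cylinder
   of the [k] low bits of [w]. *)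
Definition cond_measure (P : nat -> bool) (s k w : nat) : rat :=
  (count P (s - k) w k)%:R / 2%:R ^+ (s - k).

(** Any number [l] of free bits that reaches [s] gives the same ratio, so measures of sets with
    different [s] can share a denominator. *)
Lemma cond_measureE s P k w l : depends_below s P -> (s <= k + l)%N ->
  cond_measure P s k w = (count P l w k)%:R / 2%:R ^+ l.
Proof.
move=> dP le_s; have le_l : (s - k <= l)%N by lia.
rewrite /cond_measure -{1 2}(subnKC le_l) (count_stableD _ _ dP); last by lia.
rewrite natrM natrX exprD.
have nz j : 2%:R ^+ j != 0 :> rat by rewrite expf_neq0.
by field; rewrite !nz.
Qed.

Lemma cond_measure_ge0 P s k w : 0 <= cond_measure P s k w.
Proof. by rewrite divr_ge0 ?ler0n ?exprn_ge0. Qed.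

(** Fairness: the conditional measure is a martingale, so betting can realise it as capital. *)
Lemma cond_measure_avg s P k w : depends_below s P ->
  cond_measure P s k w =
  (cond_measure P s k.+1 w + cond_measure P s k.+1 (w + 2 ^ k)%N) / 2%:R.
Proof.
move=> dP; have le_s : (s <= k.+1 + s)%N by lia.
rewrite !(cond_measureE _ dP le_s) (cond_measureE _ dP (l := s.+1)); last by lia.
rewrite count_low natrD exprS.
have nz j : 2%:R ^+ j != 0 :> rat by rewrite expf_neq0.
by field; rewrite !nz.
Qed.

Lemma cond_measure_decided P s k w : (s <= k)%N -> cond_measure P s k w = (P w)%:R.
Proof.
move=> le_sk; rewrite /cond_measure (eqP le_sk) /count big_nat1 muln0 addn0.
by rewrite expr0 divr1.
Qed.

(** * Measure and universality of the test *)

Lemma raw_test_depends e d n s : depends_below s (raw_test e d n s).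
Proof.
move=> w; apply: eq_in_has => k; rewrite mem_iota => /andP[_ lt_k].
congr (halts_in _ (npair _ (nat_of_string _)) _); apply/eq_in_map => i.
by rewrite mem_iota => /andP[_ lt_i]; rewrite bit_mod //; lia.
Qed.

Lemma raw_test_leq e d n s s' w : (s <= s')%N ->
  raw_test e d n s w -> raw_test e d n s' w.
Proof.
move=> le_s /hasP[k]; rewrite mem_iota => lt_k kP; apply/hasP; exists k.
  by rewrite mem_iota; lia.
exact: halts_in_leq kP.
Qed.

Lemma trimmed_test_depends e d n s : depends_below s (trimmed_test e d n s).
Proof.
move=> w; apply: eq_in_has => t; rewrite mem_iota => /andP[_ lt_t].
congr (_ && _); have le_t : (t <= s)%N by lia.
exact: (depends_below_leq le_t (@raw_test_depends e d n t)) w.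
Qed.

Lemma trimmed_test_leq e d n s s' w : (s <= s')%N ->
  trimmed_test e d n s w -> trimmed_test e d n s' w.
Proof.
move=> le_s /hasP[k]; rewrite mem_iota => lt_k kP; apply/hasP; exists k => //.
by rewrite mem_iota; lia.
Qed.

(** At a small stage the trimmed set lies within the raw one; at any other stage nothing is added,
    and both sides double. *)
Lemma count_trimmed_test e d n s :
  (count (trimmed_test e d n s) s 0 0 * 2 ^ n <= 2 ^ s)%N.
Proof.
have small_case t : small e d n t ->
    (count (trimmed_test e d n t) t 0 0 * 2 ^ n <= 2 ^ t)%N.
  apply: leq_trans; rewrite leq_mul2r; apply/orP; right; apply: count_leq => v /hasP[k].
  rewrite mem_iota => lt_k /andP[+ _]; apply: raw_test_leq; lia.
elim: s => [|s IHs].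
  have [/small_case //|/negbTE not_small] := boolP (small e d n 0).
  rewrite /count /trimmed_test /= (eq_bigr (fun=> 0%N)) ?big1 //.
  by move=> v _; rewrite /= not_small andbF.
have [/small_case //|/negbTE not_small] := boolP (small e d n s.+1).
have eq_trim : trimmed_test e d n s.+1 =1 trimmed_test e d n s.
  by move=> w; rewrite /trimmed_test -[s.+2]addn1 iotaD has_cat /= not_small andbF !orbF.
rewrite /count (eq_bigr (fun v => nat_of_bool (trimmed_test e d n s (0 + 2 ^ 0 * v)%N)));
  last by move=> v _; rewrite eq_trim.
rewrite -/(count _ _ _ _) (count_stable _ (@trimmed_test_depends e d n s)) //.
by rewrite -mulnA expnS leq_mul2l.
Qed.

Lemma universal_test_depends j s : depends_below s (universal_test j s).
Proof. by move=> w; apply: eq_has => i; exact: trimmed_test_depends. Qed.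

Lemma universal_test_leq j s s' A : (s <= s')%N ->
  universal_test j s (pre A s) -> universal_test j s' (pre A s').
Proof.
move=> le_s /hasP[i]; rewrite mem_iota => lt_i iP; apply/hasP; exists i.
  by rewrite mem_iota; lia.
apply: (trimmed_test_leq le_s).
by rewrite (depends_below_pre _ (@trimmed_test_depends _ _ _ s) le_s).
Qed.

Lemma sum_geometric_bound (X : nat -> nat) (j m N : nat) :
  (forall i, i < m -> X i * 2 ^ (j + i.+1) <= N)%N ->
  ((\sum_(0 <= i < m) X i) * 2 ^ j <= N)%N.
Proof.
(* The induction needs the sharper partial sum, with factor [1 - 2^-m], here cleared of
   denominators. *)
move=> XN; suff: ((\sum_(0 <= i < m) X i) * 2 ^ (j + m) + N <= N * 2 ^ m)%N.
  have : (0 < 2 ^ m)%N by rewrite expn_gt0.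
  rewrite expnD; move: (2 ^ m)%N (2 ^ j)%N (\sum_(0 <= i < m) X i)%N => M J S M_gt0 SN.
  have : (S * J * M <= N * M)%N by lia.
  by rewrite leq_pmul2r.
elim: m XN => [|m IHm] XN; first by rewrite big_geq //= mul0n muln1.
have {}IHm := IHm (fun i lt_i => XN i (ltnW lt_i)).
have := XN m (ltnSn m); rewrite big_nat_recr //= addnS !expnS.
move: IHm; move: (\sum_(0 <= i < m) X i)%N (2 ^ (j + m))%N (2 ^ m)%N (X m) => S J M x; lia.
Qed.

(** Union bound over the tests: a string caught by several of them is counted at least once in the
    sum. *)
Lemma count_universal_test j s : (count (universal_test j s) s 0 0 * 2 ^ j <= 2 ^ s)%N.
Proof.
pose X i := count (trimmed_test (nfst i) (nsnd i) (j + i.+1) s) s 0 0.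
apply: leq_trans (sum_geometric_bound (X := X) (m := s) _); last first.
  by move=> i _; exact: count_trimmed_test.
rewrite leq_mul2r; apply/orP; right.
rewrite /X /count exchange_big_nat /=; apply: leq_sum => v _.
rewrite /universal_test has_count -sum1_count big_mkcond -[s in iota 0 s]subn0.
rewrite -/(index_iota 0 s).
rewrite [X in ((0 < X)%N <= _)%N](eq_bigr (fun i =>
  nat_of_bool (trimmed_test (nfst i) (nsnd i) (j + i.+1) s (0 + 2 ^ 0 * v)))).
  by case: (\sum_(0 <= i < s) _)%N.
by move=> i _; case: ifP.
Qed.

Definition extends_string (t : seq bool) (w : nat) : bool :=
  all (fun i => bit w i == nth false t i) (iota 0 (size t)).

Lemma extends_string_depends t : depends_below (size t) (extends_string t).
Proof.
move=> w; apply: eq_in_all => i; rewrite mem_iota => /andP[_ lt_i].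
by rewrite bit_mod.
Qed.

Lemma extends_string_pre t A :
  extends_string t (pre A (size t)) = (prefix_of A (size t) == t).
Proof.
apply/allP/eqP => [At|At i]; last first.
  rewrite mem_iota => /andP[_ lt_i].
  by rewrite bit_pre // -At nth_mkseq.
apply: (@eq_from_nth _ false) => [|i]; rewrite size_mkseq // => lt_i.
rewrite nth_mkseq // -(bit_pre A lt_i); apply/eqP/At.
by rewrite mem_iota.
Qed.

Lemma cond_measure_string t :
  cond_measure (extends_string t) (size t) 0 0 = (2%:R^-1) ^+ size t.
Proof.
rewrite /cond_measure subn0 exprVn -[RHS]div1r; congr (_ / _).
apply/eqP; rewrite pnatr_eq1; apply/eqP.
(* The only number below [2 ^ size t] that extends [t]. *)
set w0 := pre (nth false t) (size t).
rewrite /count (eq_big_nat _ _ (F2 := fun v => nat_of_bool (v == w0))).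
  rewrite (eq_bigr (fun v => if v == w0 then 1 else 0)%N) => [|v _]; last by case: eqP.
  by rewrite -big_mkcond sum1_count count_uniq_mem ?iota_uniq // mem_index_iota ltn_pre.
move=> v /andP[_ lt_v]; congr nat_of_bool; rewrite add0n mul1n.
rewrite -(modn_small lt_v) -pre_bit extends_string_pre.
apply/eqP/eqP => [vt|vw].
  apply: eq_pre => i lt_i; by rewrite -vt nth_mkseq.
by apply: (@eq_from_nth _ false) => [|i]; rewrite size_mkseq // => lt_i;
  rewrite nth_mkseq // -(bit_pre (bit v) lt_i) vw bit_pre.
Qed.

(* Compactness of Cantor space: if the bound failed, one could extend, bit by
   bit, a prefix in which the conditional measure of [P] exceeds that of the
   cover by a fixed amount; the limit would lie in [P] but not in the cover. *)
Lemma cover_bound (P : nat -> bool) (s : nat) (q : rat) (t : nat -> seq bool) :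
  depends_below s P ->
  (forall A, P (pre A s) -> exists i, prefix_of A (size (t i)) = t i) ->
  (forall N, \sum_(i < N) (2%:R^-1 : rat) ^+ size (t i) <= q) ->
  cond_measure P s 0 0 <= q.
Proof.
move=> dP cover sum_le; rewrite leNgt; apply/negP => gt_q.
pose T i := cond_measure (extends_string (t i)) (size (t i)).
pose delta := cond_measure P s 0 0 - q.
pose Inv k w := forall N, \sum_(i < N) T i k w <= cond_measure P s k w - delta.
have T_ge0 i k w : 0 <= T i k w by exact: cond_measure_ge0.
have sum_leq N N' k w : (N <= N')%N -> \sum_(i < N) T i k w <= \sum_(i < N') T i k w.
  move=> /subnKC <-; elim: (N' - N)%N => [|j IHj]; first by rewrite addn0.
  by rewrite addnS big_ord_recr /=; have := T_ge0 (N + j)%N k w; lra.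
have Inv0 : Inv 0 0.
  move=> N; rewrite /delta; apply: le_trans (_ : q <= _); last by lra.
  apply: le_trans (sum_le N); apply: ler_sum => i _.
  by rewrite /T cond_measure_string.
(* If the two children failed at [N1] and [N2], both would fail at the maximum, since partial sums
   grow; averaging would then refute the parent. *)
have InvS k w : Inv k w -> Inv k.+1 w \/ Inv k.+1 (w + 2 ^ k)%N.
  move=> Invkw; apply: NNPP => /not_or_and[/not_all_ex_not[N1 nN1] /not_all_ex_not[N2 nN2]].
  move/negP: nN1; move/negP: nN2; rewrite -!ltNge => lt2 lt1.
  have := Invkw (maxn N1 N2); rewrite (cond_measure_avg _ _ dP).
  have -> : \sum_(i < maxn N1 N2) T i k w = (\sum_(i < maxn N1 N2) T i k.+1 w +
       \sum_(i < maxn N1 N2) T i k.+1 (w + 2 ^ k)%N) / 2%:R.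
    rewrite -big_split /= mulr_suml; apply: eq_bigr => i _.
    exact: cond_measure_avg (@extends_string_depends _).
  have := sum_leq _ _ k.+1 w (leq_maxl N1 N2).
  have := sum_leq _ _ k.+1 (w + 2 ^ k)%N (leq_maxr N1 N2).
  lra.
pose next k w := if excluded_middle_informative (Inv k.+1 w) then false else true.
have nextP k w : Inv k w -> Inv k.+1 (w + next k w * 2 ^ k)%N.
  move=> /InvS; rewrite /next; case: (excluded_middle_informative _) => [Inv1 _|nInv [//|]].
    by rewrite mul0n addn0.
  by rewrite mul1n.
pose W := fix W k := if k is k'.+1 then (W k' + next k' (W k') * 2 ^ k')%N else 0%N.
pose A : real := fun k => next k (W k).
have preA k : pre A k = W k.
  by elim: k => [|k IHk]; [rewrite /pre big_geq | rewrite preS IHk].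
have InvA k : Inv k (pre A k).
  by rewrite preA; elim: k => //= k /nextP.
have PA : P (pre A s).
  apply: contraT => /negbTE nP; have := InvA s 0%N.
  by rewrite big_ord0 cond_measure_decided // nP mulr0n /delta; lra.
have [i Ai] := cover A PA.
(* At this depth [P] and the [i]-th cylinder are both decided with measure 1, which leaves no room
   for [delta > 0]. *)
have := InvA (maxn s (size (t i))) i.+1.
have : \sum_(j < i) T j (maxn s (size (t i))) (pre A (maxn s (size (t i)))) >= 0.
  by apply: sumr_ge0.
rewrite big_ord_recr /= {3}/T !cond_measure_decided ?leq_maxl ?leq_maxr //.
rewrite (depends_below_pre A dP) ?leq_maxl // PA.
rewrite (depends_below_pre A (@extends_string_depends (t i))) ?leq_maxr //.
by rewrite extends_string_pre Ai eqxx /delta; lra.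
Qed.

Lemma cond_measure_le_count P s n : (count P s 0 0 * 2 ^ n <= 2 ^ s)%N =
  (cond_measure P s 0 0 <= 2%:R^-1 ^+ n).
Proof.
rewrite /cond_measure subn0 exprVn ler_pdivrMr ?exprn_gt0 //.
by rewrite mulrC ler_pdivlMr ?exprn_gt0 // -!natrX -natrM ler_nat.
Qed.

(** Trimming never rejects a stage of a genuine test: translating a cover of [V n] by [d] keeps the
    lengths and covers the raw set, so compactness bounds its measure. *)
Lemma ml_test_small V c d n s : measure_le (V n) (2%:R^-1 ^+ n) ->
  (forall A, V n A <->
     exists k, halts c (npair n (nat_of_string (prefix_of A k)))) ->
  small (code_number c) d n s.
Proof.
move=> Vn cV; rewrite /small cond_measure_le_count; apply/ler_addgt0Pr => eps eps_gt0.
have [t [cover sum_le]] := Vn _ eps_gt0.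
pose u i := mkseq (fun j => nth false (t i) j (+) bit d j) (size (t i)).
apply: (@cover_bound _ _ _ u); [exact: raw_test_depends| |]; last first.
  move=> N; apply: le_trans (sum_le N); apply: ler_sum => i _.
  by rewrite size_mkseq.
move=> A /hasP[k]; rewrite mem_iota => lt_k kP.
have /cover[i iP] : V n (fun j => A j (+) bit d j).
  apply/cV; exists k; apply/halts_inP; exists s; move: kP.
  congr (is_true (halts_in _ (npair _ (nat_of_string _)) _)).
  apply/eq_in_map => j; rewrite mem_iota => /andP[_ lt_j].
  by rewrite bit_pre //; lia.
exists i; apply: (@eq_from_nth _ false); rewrite !size_mkseq // => j lt_j.
by rewrite !nth_mkseq // -iP nth_mkseq // addbK.
Qed.

(** A test that captures [Y], paired with the modification [d], is one of the indices [i], and its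
    member [j + i + 1] contributes to level [j]. *)
Lemma universal_test_complete (A Y : real) d : (forall i, Y i = A i (+) bit d i) ->
  ~ MLR Y -> forall j, exists s, universal_test j s (pre A s).
Proof.
move=> YA nMLR j; have [V [[[c cV] mV] VY]] : exists V, ml_test V /\ forall n, V n Y.
  apply: NNPP => nV; apply: nMLR => V tV VY; apply: nV; by exists V.
pose i := npair (code_number c) d.
have [k /halts_inP[s0 s0P]] := (cV _ _).1 (VY (j + i.+1)%N).
(* Large enough for the prefix length [k], the running time [s0] and the index [i]. *)
pose s := (k + s0 + i.+1)%N.
exists s; apply/hasP; exists i; first by rewrite mem_iota /s; lia.
rewrite /i !npairE; apply/hasP; exists s; first by rewrite mem_iota; lia.
apply/andP; split; last exact: ml_test_small (mV _) (cV _).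
apply/hasP; exists k; first by rewrite mem_iota /s; lia.
rewrite (_ : mkseq _ k = prefix_of Y k).
  by apply: halts_in_leq s0P; rewrite /s; lia.
apply/eq_in_map => l; rewrite mem_iota YA => /andP[_ lt_l].
by rewrite bit_pre // /s; lia.
Qed.

(** * The functional *)

Local Open Scope nat_scope.

Definition half (b : bool) (X : real) : real := fun n => X (2 * n + b).

(** The number of switches is the whole state: its parity names the half being copied, its quotient
    by 2 the level. The divisor is written [2 ^ 1] to match [computable_div_exp2]. *)
Definition switches (X : real) (n : nat) : nat :=
  iteri n (fun t p => p + universal_test (p %/ 2 ^ 1) t (pre (half (odd p) X) t)) 0.

Definition switching (X : real) : real := fun n => half (odd (switches X n)) X n.

Lemma computable_switching : computable_pred (fun X n => switching X n).
Proof. by rewrite /switching /switches /half /pre; computability. Qed.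

Lemma switchesS X n : switches X n.+1 = switches X n +
  universal_test (switches X n %/ 2) n (pre (half (odd (switches X n)) X) n).
Proof. by []. Qed.

Lemma switches_leq X m n : m <= n -> switches X m <= switches X n.
Proof.
move=> /subnKC <-; elim: (n - m) => [|k IHk]; first by rewrite addn0.
by rewrite addnS switchesS (leq_trans IHk) // leq_addr.
Qed.

Lemma MLR_or_covered X : MLR (switching X) \/
  forall b j, exists s, universal_test j s (pre (half b X) s).
Proof.
have [[p bounded]|unbounded] := classic (exists p, forall n, switches X n <= p); last first.
  right=> b j; have: exists n, j.*2 + b < switches X n.
    apply: NNPP => nn; apply: unbounded; exists (j.*2 + b) => n.
    by rewrite leqNgt; apply/negP => lt_n; apply: nn; exists n.
  (* The count grows by at most one per stage, so just before it first exceeds [2j + b] it equals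
     [2j + b]; the switch made there catches half [b] at level [j]. *)
  move=> ex_n; case: (ex_minnP ex_n) => -[//|n] lt_n min_n; exists n.
  have le_n : switches X n <= j.*2 + b.
    by rewrite leqNgt; apply/negP => /min_n; rewrite ltnn.
  move: lt_n; rewrite switchesS.
  have [uP lt_n|_] := boolP (universal_test _ _ _); last by move=> /=; lia.
  have nE : switches X n = j.*2 + b by move: lt_n => /=; lia.
  move: uP; rewrite nE oddD odd_double oddb divn2.
  by rewrite (_ : (j.*2 + b)./2 = j) //; case: b {nE lt_n le_n min_n ex_n}; lia.
have [N maxN] : exists N, forall n, switches X n <= switches X N.
  elim: p bounded => [|p IHp] bounded.
    by exists 0 => n; have := bounded n; lia.
  have [[n gt_n]|none] := classic (exists n, p < switches X n).
    by exists n => m; apply: leq_trans (bounded m) _.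
  by apply: IHp => n; rewrite leqNgt; apply/negP => lt_n; apply: none; exists n.
set q := switches X N in maxN.
have qE n : N <= n -> switches X n = q.
  by move=> le_n; apply/eqP; rewrite eqn_leq maxN switches_leq.
left; apply: NNPP => nMLR.
(* The output agrees with the final half from [N] on, so the first [N] bits of [D] code the finite
   modification. *)
pose D : real := fun i => switching X i (+) half (odd q) X i.
have [|s sP] := @universal_test_complete (half (odd q) X) _ (pre D N) _ nMLR (q %/ 2).
  move=> i; have [lt_i|le_i] := ltnP i N.
    by rewrite bit_pre // /D addbC addbK.
  rewrite /bit divn_small ?addbF; first by rewrite /switching qE.
  by apply: leq_trans (ltn_pre _ _) _; rewrite leq_exp2l.
(* Level [q %/ 2] catches the final half, which would cause one more switch after [N]. *)
have := qE (maxn N s).+1 (leqW (leq_maxl _ _)).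
rewrite switchesS qE ?leq_maxl //.
rewrite (universal_test_leq (leq_maxr N s) sP); lia.
Qed.

(** * The betting strategy *)

Local Open Scope nat_scope.

(** Walks down a coded list by iterating its tail. A code bounds the length of its list, so [x]
    rounds suffice, and the empty list [0] contributes nothing. *)
Definition history_sum (G : nat -> nat) (x : nat) : nat :=
  \sum_(0 <= t < x) (if iter t (fun y => nsnd y.-1) x == 0 then 0
                     else G (nfst (iter t (fun y => nsnd y.-1) x).-1)).

Lemma history_sum_cons G x s :
  history_sum G (nat_of_seq (x :: s)) = G x + history_sum G (nat_of_seq s).
Proof.
pose tl y := nsnd y.-1.
pose H y t := if iter t tl y == 0 then 0 else G (nfst (iter t tl y).-1).
have tl0 t : iter t tl 0 = 0.
  elim: t => //= t ->; apply/eqP; rewrite -leqn0.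
  by apply: leq_trans (leq_nsnd_npair (nfst 0) _) _; rewrite npair_eta.
(* The bound is loosened to any [m] above the code, since the induction passes to the tail, whose
   code is smaller. *)
have extend l m : nat_of_seq l <= m ->
    \sum_(0 <= t < m) H (nat_of_seq l) t = \sum_(y <- l) G y.
  elim: l m => [|y l IHl] m.
    by rewrite big_nil => _; apply: big1 => t _; rewrite /H tl0.
  case: m => //= m; rewrite ltnS => le_m; rewrite big_nat_recl // big_cons {1}/H /= nfst_npair.
  congr (_ + _); rewrite -(IHl m); last exact: leq_trans (leq_nsnd_npair _ _) le_m.
  by apply: eq_bigr => t _; rewrite /H iterSr /tl /= nsnd_npair.
by rewrite /history_sum !(extend _ _ (leqnn _)) big_cons.
Qed.

Definition bits_read (b : bool) (x : nat) : nat :=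
  history_sum (fun e => odd (nfst e) == b) x.

Definition prefix_read (b : bool) (x : nat) : nat :=
  history_sum (fun e => (odd (nfst e) == b) * (nsnd e * 2 ^ (nfst e %/ 2 ^ 1))) x.

Lemma bits_read_cons b p v h : bits_read b (nat_of_history ((p, v) :: h)) =
  (odd p == b) + bits_read b (nat_of_history h).
Proof. by rewrite /bits_read history_sum_cons /= nfst_npair. Qed.

Lemma prefix_read_cons b p v h : prefix_read b (nat_of_history ((p, v) :: h)) =
  (odd p == b) * (v * 2 ^ (p %/ 2)) + prefix_read b (nat_of_history h).
Proof. by rewrite /prefix_read history_sum_cons /= !npairE. Qed.

(* The least [t] such that [universal_test j t u], if it is at most [r]. *)
Definition hit_time (j r u : nat) : nat :=
  \sum_(0 <= t < r) ~~ universal_test j t u.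

(** Level [k] is bought at bit [k], so betting there waits until levels [0] to [k] have all caught
    the other half. *)
Definition ready (k r u : nat) : bool :=
  all (fun m => universal_test (2 * m) r u) (iota 0 k.+1).

(** The value of all owned levels if the next bit is [b], in units of [2^-r]: hit times are at most
    [r], so [r] free bits decide every level. *)
Definition payoff (k r w u : nat) (b : bool) : nat :=
  \sum_(0 <= m < k.+1)
    count (universal_test (2 * m) (hit_time (2 * m) r u)) r (w + b * 2 ^ k) k.+1.

(** The stake is half the absolute difference of the two payoffs, a sum of truncated differences.
    The predecessor offsets the [d + 1] in the naming of stakes. While waiting, the next bit of the
    other half is read at stake 0. *)
Definition bet_number (i : bool) (k r w u : nat) : nat :=
  if ready k r u then
    npair (2 * k + i)
      (npair (npair (payoff k r w u true - payoff k r w u false +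
                     (payoff k r w u false - payoff k r w u true))
                    (2 ^ r.+1).-1)
             (payoff k r w u false <= payoff k r w u true))
  else npair (2 * r + ~~ i) (npair (npair 0 0) 0).

Definition kl_bet (i : bool) (x : nat) : nat :=
  bet_number i (bits_read i x) (bits_read (~~ i) x)
    (prefix_read i x) (prefix_read (~~ i) x).

Definition kl_strategy (i : bool) : strategy :=
  fun h => Some (bet_of_nat (kl_bet i (nat_of_history h))).

Lemma computable_hit_time j r u : computable j -> computable r -> computable u ->
  computable (fun X n => hit_time (j X n) (r X n) (u X n)).
Proof. by move=> cj cr cu; rewrite /hit_time; computability. Qed.

Lemma computable_payoff k r w u b : computable k -> computable r ->
  computable w -> computable u ->
  computable (fun X n => payoff (k X n) (r X n) (w X n) (u X n) b).
Proof.
move=> ck cr cw cu; rewrite /payoff /count; computability.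
by apply: computable_hit_time; computability.
Qed.

Lemma computable_bits_read b f :
  computable f -> computable (fun X n => bits_read b (f X n)).
Proof.
by move=> cf; rewrite /bits_read /history_sum; computability.
Qed.

Lemma computable_prefix_read b f :
  computable f -> computable (fun X n => prefix_read b (f X n)).
Proof.
by move=> cf; rewrite /prefix_read /history_sum; computability.
Qed.
Ltac computable_extra ::=
  lazymatch goal with
  | |- computable (fun X n => nat_of_bool (universal_test _ _ _)) =>
    apply: computable_universal_test
  | |- computable (fun X n => payoff _ _ _ _ _) => apply: computable_payoff
  | |- computable (fun X n => bits_read _ _) => apply: computable_bits_read
  | |- computable (fun X n => prefix_read _ _) => apply: computable_prefix_read
  end.

Lemma computable_kl_bet i : computable (fun X n => kl_bet i n).
Proof. by rewrite /kl_bet /bet_number /ready; computability. Qed.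

Lemma kl_strategy_computable i : partial_computable (kl_strategy i).
Proof.
have [c cP] := computable_kl_bet i.
exists c => h b; split=> [[<-]|[v vP <-]].
  by exists (kl_bet i (nat_of_history h)) => //; exact: cP.
by rewrite /kl_strategy (eval_functional vP (cP _ _)).
Qed.

Lemma hit_time_leq j r u : hit_time j r u <= r.
Proof.
rewrite /hit_time -{2}[r]subn0 -[r - 0]muln1 -sum_nat_const_nat.
by apply: leq_sum => t _; case: universal_test.
Qed.

(** Once caught, a prefix stays caught, so no further stage is counted. *)
Lemma hit_time_pre j r r' B : universal_test j r (pre B r) -> r <= r' ->
  hit_time j r' (pre B r') = hit_time j r (pre B r).
Proof.
move=> rP le_r; rewrite /hit_time (big_cat_nat (leq0n r)) //=.
rewrite [X in _ + X]big_nat_cond [X in _ + X]big1 ?addn0; last first.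
  move=> t /andP[/andP[le_t lt_t] _]; apply/eqP; rewrite eqb0 negbK.
  rewrite (depends_below_pre _ (@universal_test_depends j t)); last exact: ltnW.
  exact: universal_test_leq le_t rP.
apply: eq_big_nat => t /andP[_ lt_t]; congr (nat_of_bool (~~ _)).
transitivity (universal_test j t (pre B t)); [|symmetry];
  apply: (depends_below_pre _ (@universal_test_depends j t)); lia.
Qed.

Lemma hit_time_geq j r B s : (forall t, t < s -> ~~ universal_test j t (pre B t)) ->
  s <= r -> s <= hit_time j r (pre B r).
Proof.
move=> none le_s; rewrite /hit_time (big_cat_nat (leq0n s)) //=.
apply: leq_trans (leq_addr _ _).
rewrite (eq_big_nat _ _ (F2 := fun=> 1)) ?sum_nat_const_nat; first by lia.
move=> t /andP[_ lt_t]; rewrite (depends_below_pre _ (@universal_test_depends j t)); last by lia.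
by rewrite none.
Qed.

Lemma hit_time_bound j r s B : universal_test j s (pre B s) ->
  hit_time j r (pre B r) <= s.
Proof.
move=> sP; have [le_r|/ltnW le_s] := leqP r s.
  exact: leq_trans (hit_time_leq _ _ _) le_r.
by rewrite (hit_time_pre sP le_s) hit_time_leq.
Qed.

Local Open Scope ring_scope.

(** * Value and price of the levels *)

Definition level_measure (A B : real) (r m k : nat) : rat :=
  let s := hit_time (2 * m) r (pre B r) in
  cond_measure (universal_test (2 * m) s) s k (pre A k).

(** Even if the whole set lies in the cylinder, conditioning on [k] bits multiplies its measure by
    at most [2^k]. *)
Lemma cond_measure_universal_test j s k w : (w < 2 ^ k)%N ->
  cond_measure (universal_test j s) s k w <= 2%:R ^+ k * 2%:R^-1 ^+ j.
Proof.
move=> lt_w; have dU := @universal_test_depends j s.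
rewrite (cond_measureE _ dU (l := s)); last by lia.
have : cond_measure (universal_test j s) s 0 0 <= 2%:R^-1 ^+ j.
  by rewrite -cond_measure_le_count count_universal_test.
rewrite (cond_measureE _ dU (l := s)) // => le_j.
apply: le_trans (_ : _ <= 2%:R ^+ k *
  ((count (universal_test j s) s 0 0)%:R / 2%:R ^+ s)) _.
  rewrite mulrA ler_wpM2r ?invr_ge0 ?exprn_ge0 // -natrX -natrM ler_nat.
  by rewrite -(count_stableD k _ dU) // [(s + k)%N]addnC count_prefix.
by rewrite ler_wpM2l ?exprn_ge0.
Qed.

(** This is why even levels are used: conditioning level [2m] on [m] bits still leaves
    [2^m * 2^-(2m) = 2^-m]. *)
Lemma level_measure_start A B r m : level_measure A B r m m <= 2%:R^-1 ^+ m.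
Proof.
apply: le_trans (cond_measure_universal_test _ _ (ltn_pre _ _)) _.
by rewrite mul2n -addnn exprD mulrA -exprMn divff // expr1n mul1r.
Qed.

Lemma sum_level_measure_start A B r k :
  \sum_(0 <= m < k) level_measure A B r m m <= 2%:R.
Proof.
apply: le_trans (_ : 2%:R - 2%:R * 2%:R^-1 ^+ k <= _); last first.
  by rewrite gerBl mulr_ge0 // exprn_ge0 // invr_ge0.
elim: k => [|k IHk]; first by rewrite big_geq // expr0; lra.
rewrite big_nat_recr //= exprS; have := level_measure_start A B r k.
move: IHk; move: (2%:R^-1 ^+ k) => y; lra.
Qed.
Local Open Scope nat_scope.

(* After reading [k] bits of [half i X] and [r] bits of the other half, the
   strategy owns, for each level [m < k], the conditional measure of the
   level since it was bought, at the [m]-th bit of [half i X]. *)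
Definition play_state (i : bool) (X : real) (k r : nat) (h : history) (q : rat) : Prop :=
  let x := nat_of_history h in let B := half (~~ i) X in
  [/\ [/\ bits_read i x = k, bits_read (~~ i) x = r,
          prefix_read i x = pre (half i X) k & prefix_read (~~ i) x = pre B r],
      (forall p, p \in [seq pb.1 | pb <- h] -> p %/ 2 < if odd p == i then k else r),
      (forall m, m < k -> universal_test (2 * m) r (pre B r)) &
      q = (2%:R + \sum_(0 <= m < k) (level_measure (half i X) B r m k -
                                    level_measure (half i X) B r m m))%R].

(** * The invariant of the play *)

Lemma bet_of_natE p a d g :
  bet_of_nat (npair p (npair (npair a d) g)) = Bet p (a%:R / d.+1%:R)%R (g != 0).
Proof. by rewrite /bet_of_nat !npairE. Qed.

Lemma level_measure_later A B r r' m k :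
  universal_test (2 * m) r (pre B r) -> r <= r' ->
  level_measure A B r' m k = level_measure A B r m k.
Proof. by move=> rP le_r; rewrite /level_measure (hit_time_pre rP le_r). Qed.

Lemma play_state0 i X : play_state i X 0 0 [::] 2%:R.
Proof.
have read0 G : history_sum G 0 = 0 by rewrite /history_sum big_geq.
split=> //; last by rewrite big_geq // addr0.
by rewrite /bits_read /prefix_read /pre !read0 !big_geq.
Qed.

Lemma half_position (b : bool) n : (odd (2 * n + b) = b) * ((2 * n + b) %/ 2 = n).
Proof.
rewrite oddD mul2n odd_double oddb addFb; split=> //.
by rewrite divn2; case: b; lia.
Qed.

(** The levels below [k] have already caught the other half; their hit times, and hence the owned
    sets, are fixed. *)
Lemma play_state_wait i X k r h q : play_state i X k r h q ->
  play_state i X k r.+1 ((2 * r + ~~ i, X (2 * r + ~~ i)) :: h) q.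
Proof.
move=> [[ki ri wi ui] pos lev qE]; have [oddr halfr] := half_position (~~ i) r.
have lev' m : m < k -> universal_test (2 * m) r.+1 (pre (half (~~ i) X) r.+1).
  by move=> /lev; apply: universal_test_leq.
split=> //.
- rewrite !bits_read_cons !prefix_read_cons ki ri wi ui oddr halfr preS eqxx.
  have -> : (~~ i == i) = false by case: (i).
  by rewrite !mul0n !add0n mul1n; split=> //; rewrite addnC ?addn1.
- move=> p; rewrite in_cons => /orP[/eqP->|/pos]; last by case: ifP => // _; lia.
  by rewrite oddr halfr; case: (i) => /=; rewrite ltnSn.
- rewrite qE; congr (_ + _)%R; apply: eq_big_nat => m /andP[_ /lev m_hit].
  by rewrite !(level_measure_later _ _ m_hit).
Qed.

Lemma payoffE i X k r b (A := half i X) (B := half (~~ i) X) :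
  ((payoff k r (pre A k) (pre B r) b)%:R / 2%:R ^+ r =
   \sum_(0 <= m < k.+1)
      cond_measure (universal_test (2 * m) (hit_time (2 * m) r (pre B r)))
        (hit_time (2 * m) r (pre B r)) k.+1 (pre A k + b * 2 ^ k)%N :> rat)%R.
Proof.
rewrite /payoff natr_sum mulr_suml; apply: eq_bigr => m _.
rewrite (cond_measureE _ (@universal_test_depends _ _) (l := r)) //.
by have := hit_time_leq (2 * m) r (pre B r); lia.
Qed.

Lemma stakeE (N0 N1 r : nat) :
  ((N1 - N0 + (N0 - N1))%:R / (2 ^ r.+1).-1.+1%:R =
   `|N1%:R / 2%:R ^+ r - N0%:R / 2%:R ^+ r| / 2%:R :> rat)%R.
Proof.
rewrite prednK ?expn_gt0 // natrX exprS -mulrBl normrM [(`|_^-1|)%R]ger0_norm; last first.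
  by rewrite invr_ge0 exprn_ge0.
rewrite -mulrA -invfM [(2%:R * _)%R]mulrC; congr (_ / _)%R.
have [le01|/ltnW le10] := leqP N0 N1.
  by rewrite (eqP le01) addn0 natrB // ger0_norm // subr_ge0 ler_nat.
by rewrite (eqP le10) add0n natrB // distrC ger0_norm // subr_ge0 ler_nat.
Qed.

Local Open Scope ring_scope.

Lemma play_state_bet i X k r h q (A := half i X) (B := half (~~ i) X)
    (V := fun b => (payoff k r (pre A k) (pre B r) b)%:R / 2%:R ^+ r : rat) :
  play_state i X k r h q -> ready k r (pre B r) ->
  `|V true - V false| / 2%:R <= q /\
  play_state i X k.+1 r ((2 * k + i, X (2 * k + i))%N :: h)
    (q + (V (A k) - (V true + V false) / 2%:R)).
Proof.
move=> [[ki ri wi ui] pos lev qE] /allP ready_r.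
have avg : \sum_(0 <= m < k.+1) level_measure A B r m k = (V true + V false) / 2%:R.
  rewrite /V !payoffE -big_split /= mulr_suml; apply: eq_bigr => m _.
  rewrite /level_measure (cond_measure_avg _ _ (@universal_test_depends _ _)).
  by rewrite mul0n mul1n addn0 [X in X / _]addrC.
have next : \sum_(0 <= m < k.+1) level_measure A B r m k.+1 = V (A k).
  by rewrite /V payoffE; apply: eq_bigr => m _; rewrite /level_measure preS.
(* Level [k] is bought now at its present value, so its term is 0 and the capital is unchanged. *)
have qE' : q = 2%:R + \sum_(0 <= m < k.+1)
    (level_measure A B r m k - level_measure A B r m m).
  by rewrite big_nat_recr //= subrr addr0.
have V_ge0 b : 0 <= V b by rewrite divr_ge0 ?ler0n ?exprn_ge0.
have start := sum_level_measure_start A B r k.+1.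
move: qE'; rewrite sumrB avg => qE'.
split.
  (* All prices together are at most 2, so [q] is at least the average payoff, which bounds half the
     difference of two nonnegative payoffs. *)
  have := V_ge0 true; have := V_ge0 false.
  by rewrite ler_pdivrMr // ler_norml => V0 V1; apply/andP; split; lra.
have [oddk halfk] := half_position i k.
split=> //.
- rewrite !bits_read_cons !prefix_read_cons ki ri wi ui oddk halfk preS eqxx.
  have -> : (i == ~~ i) = false by case: (i).
  by rewrite !mul0n !add0n mul1n; split=> //; rewrite addnC ?addn1.
- move=> p; rewrite in_cons => /orP[/eqP->|/pos]; last by case: ifP => // _; lia.
  by rewrite oddk halfk eqxx.
- by move=> m lt_m; apply: ready_r; rewrite mem_iota.
- by rewrite sumrB next qE' -/A -/B; lra.
Qed.

Lemma kl_strategy_step i X k r h q b :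
  play_state i X k r h q -> kl_strategy i h = Some b ->
  let h' := (position b, X (position b)) :: h in
  let q' := if X (position b) == prediction b then q + stake b else q - stake b in
  [/\ position b \notin [seq pb.1 | pb <- h], 0 <= stake b <= q &
      if ready k r (pre (half (~~ i) X) r) then play_state i X k.+1 r h' q'
      else play_state i X k r.+1 h' q'].
Proof.
move=> st [<-]; have [[ki ri wi ui] pos lev qE] := st.
rewrite /kl_bet ki ri wi ui /bet_number.
have := play_state_bet st; set A := half i X; set B := half (~~ i) X.
case: (boolP (ready _ _ _)) => [rdy|nrdy].
  move=> /(_ isT) [stake_le st']; rewrite bet_of_natE /= stakeE.
  move: stake_le st'; rewrite -/A -/B.
  set V1 := _%:R / _; set V0 := _%:R / _ => stake_le st'.
  split.
  - apply/negP => /pos; rewrite !half_position eqxx; lia.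
  - by rewrite stake_le andbT mulr_ge0.
  - have le01 : (payoff k r (pre A k) (pre B r) false <=
        payoff k r (pre A k) (pre B r) true)%N = (V0 <= V1).
      by rewrite /V0 /V1 ler_pM2r ?invr_gt0 ?exprn_gt0 // ler_nat.
    rewrite eqb0 negbK le01; move: st'; rewrite (_ : A k = X (2 * k + i)%N) //.
    congr play_state.
    by case: (X _); rewrite -/V1 -/V0; case: (lerP V0 V1) => cmp /=; lra.
move=> _; rewrite bet_of_natE /= mul0r !(addr0, subr0) if_same; split.
- apply/negP => /pos; rewrite !half_position; case: (i) => /=; lia.
- rewrite qE -/A -/B sumrB.
  have := sum_level_measure_start A B r k.
  have : 0 <= \sum_(0 <= m < k) level_measure A B r m k.
    by apply: sumr_ge0 => m _; exact: cond_measure_ge0.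
  lra.
- exact: play_state_wait.
Qed.

Lemma kl_strategy_state i X n h q : play (kl_strategy i) 2%:R X n = Some (h, q) ->
  exists k r, play_state i X k r h q.
Proof.
elim: n h q => [|n IHn] h q /=.
  by move=> [<- <-]; exists 0%N, 0%N; exact: play_state0.
case: play IHn => [[h1 q1] /(_ _ _ erefl) [k [r st]]|//] [<- <-].
have [_ _] := kl_strategy_step st erefl.
by case: ifP => _ ?; [exists k.+1, r | exists k, r.+1].
Qed.

Lemma kl_strategy_betting i : betting_strategy (kl_strategy i) 2%:R.
Proof.
split=> // X n h q b /kl_strategy_state[k [r st]] hb.
by have [] := kl_strategy_step st hb.
Qed.

Lemma kl_strategy_reads i X K :
  (forall j, exists s, universal_test j s (pre (half (~~ i) X) s)) ->
  exists n r h q, play (kl_strategy i) 2%:R X n = Some (h, q) /\ play_state i X K r h q.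
Proof.
move=> covered; elim: K => [|K [n [r [h [q [hq st]]]]]].
  by exists 0%N, 0%N, [::], 2%:R; split=> //; exact: play_state0.
have [R RP] : exists R, ready K R (pre (half (~~ i) X) R).
  rewrite /ready; elim: (K.+1) => [|k [R RP]]; first by exists 0%N.
  have [s sP] := covered (2 * k)%N; exists (maxn R s).
  rewrite -[k.+1]addn1 iotaD all_cat /= andbT; apply/andP; split.
    by apply: sub_all RP => m; apply: universal_test_leq; exact: leq_maxl.
  by apply: universal_test_leq sP; exact: leq_maxr.
have : (R <= r + R)%N by exact: leq_addl.
(* [d] bounds the number of waiting moves left before [r] reaches [R], where the strategy must
   bet. *)
move: {2}R => d; elim: d n r h q hq st => [|d IHd] n r h q hq st le_R;
  have [_ _] := kl_strategy_step st erefl; case: ifP => [_ st'|not_ready st'].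
- by exists n.+1, r; do 2!eexists; split; last exact: st'; rewrite /= hq.
- case/negP: not_ready; move: RP; apply: sub_all => m; apply: universal_test_leq; lia.
- by exists n.+1, r; do 2!eexists; split; last exact: st'; rewrite /= hq.
- by apply: (IHd n.+1) st' _; [rewrite /= hq | lia].
Qed.

(* Level [2 * m] of the universal test catches [half i X] no later than the
   other half. *)
Definition early (i : bool) (X : real) (m : nat) : Prop :=
  exists s, universal_test (2 * m) s (pre (half i X) s) /\
    forall t, (t < s)%N -> ~~ universal_test (2 * m) t (pre (half (~~ i) X) t).

Lemma early_level_measure i X m r k s : early i X m ->
  universal_test (2 * m) s (pre (half (~~ i) X) s) ->
  universal_test (2 * m) r (pre (half (~~ i) X) r) -> (s <= k)%N ->
  level_measure (half i X) (half (~~ i) X) r m k = 1.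
Proof.
move=> [s0 [s0P none]] sP rP le_k; set B := half (~~ i) X in sP rP none *.
have le_s0 : (s0 <= r)%N.
  by rewrite leqNgt; apply/negP => /none; rewrite rP.
have le_hit := hit_time_geq none le_s0.
have hit_k := leq_trans (hit_time_bound r sP) le_k.
rewrite /level_measure cond_measure_decided //.
rewrite (depends_below_pre _ (@universal_test_depends _ _) hit_k).
by rewrite (universal_test_leq le_hit s0P).
Qed.

Lemma kl_strategy_wins i X (B := half (~~ i) X) :
  (forall j, exists s, universal_test j s (pre B s)) ->
  (forall N, exists2 m, (N <= m)%N & early i X m) ->
  succeeds (kl_strategy i) 2%:R X.
Proof.
move=> covered often; split.
  by elim=> //= n; case: play => [[h q]|].
move=> bound.
have lm_ge0 r m k : 0 <= level_measure (half i X) B r m k by exact: cond_measure_ge0.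
(* [a] bounds both the levels needed for [L] early ones and the bits needed to decide them. *)
have sum_ge (L : nat) : exists a : nat, forall k r, (a <= k)%N ->
    (forall m, (m < k)%N -> universal_test (2 * m) r (pre B r)) ->
    L%:R <= \sum_(0 <= m < a) level_measure (half i X) B r m k.
  elim: L => [|L [a aP]].
    by exists 0%N => k r _ _; rewrite big_geq.
  have [m le_m em] := often a; have [s sP] := covered (2 * m)%N.
  (* This counts the new early level [m] and reads past the stage [s] at which it has caught the
     other half. *)
  exists (maxn m.+1 s) => k r; rewrite geq_max => /andP[lt_m le_s] caught.
  have le_ak : (a <= k)%N by lia.
  have sumL := aP k r le_ak caught.
  have lmE := early_level_measure em sP (caught m lt_m) le_s.
  rewrite (big_cat_nat (leq0n m.+1)) ?leq_maxl //=.
  rewrite big_nat_recr //= lmE (big_cat_nat (leq0n a) le_m) /=.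
  have ge0 x y : 0 <= \sum_(x <= l < y) level_measure (half i X) B r l k by apply: sumr_ge0.
  rewrite -natr1; have := ge0 a m; have := ge0 m.+1 (maxn m.+1 s); move: sumL; lra.
have [L bound_lt] : exists L : nat, bound < L%:R.
  exists (Num.bound `|bound|); exact: le_lt_trans (ler_norm _) (archi_boundP (normr_ge0 _)).
have [a aP] := sum_ge L; have [n [r [h [q [hq st]]]]] := kl_strategy_reads a covered.
exists n, h, q; split=> //; have [_ _ caught qE] := st.
(* The initial capital 2 covers all prices, so the capital is at least the value of the owned
   levels. *)
rewrite qE sumrB; have := aP a r (leqnn a) caught.
have := sum_level_measure_start (half i X) B r a; rewrite -/B; lra.
Qed.

(** * The reduction *)

Theorem theorem2 : medvedev_le MLR KLR.
Proof.
have [c cP] := computable_switching.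
exists c => X KLX; exists (switching X); first exact: cP.
have [//|covered] := MLR_or_covered X.
(* The half with the smaller first hit is early; a tie favours [true]. *)
have early_or m : early true X m \/ early false X m.
  case: (ex_minnP (covered true (2 * m)%N)) => s1 s1P min1.
  case: (ex_minnP (covered false (2 * m)%N)) => s0 s0P min0.
  have [le10|le01] := leqP s1 s0; [left|right].
    exists s1; split=> // t lt_t; apply/negP => /min0; lia.
  exists s0; split=> // t lt_t; apply/negP => /min1; lia.
(* Pigeonhole: if each half were early only finitely often, some large level would be early for
   neither. *)
have [i often] : exists i, forall N, exists2 m, (N <= m)%N & early i X m.
  apply: NNPP => none; have rare i : exists N, forall m, (N <= m)%N -> ~ early i X m.
    apply: NNPP => nrare; apply: none; exists i => N; apply: NNPP => nN.
    by apply: nrare; exists N => m le_m em; apply: nN; exists m.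
  have [N1 N1P] := rare true; have [N0 N0P] := rare false.
  case: (early_or (maxn N1 N0)) => [/N1P|/N0P]; apply; [exact: leq_maxl|exact: leq_maxr].
case: (KLX _ _ (kl_strategy_betting i) (kl_strategy_computable i)).
exact: kl_strategy_wins (covered (~~ i)) often.
Qed.
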